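(* Let $k$ be a positive integer and suppose that for infinitely many primes $p$, every nice subset of $\mathbb{Z}_p$ of size $k$ admits an Alspach ordering. Then for every torsion-free abelian group $G$, every nice subset of $G$ of size $k$ admits an Alspach ordering.
   Context: A finite subset $A$ of an abelian group $G$ is called nice if $0_G\notin A$ and $\sum_{z\in A} z\neq 0_G$. For a finite subset $A=\{x_1,\dots,x_k\}$ of $G$ and an ordering $\omega=(x_{j_1},\dots,x_{j_k})$ of its elements, the partial sums are $s_i(\omega)=x_{j_1}+\dots+x_{j_i}$ for $i=1,\dots,k$. An ordering $\omega$ of $A$ is called an Alspach ordering if $s_i(\omega)\neq 0_G$ for all $i$ and $s_i(\omega)\neq s_j(\omega)$ for all $1\le i<j\le k$. *)

(* Defs.v *)
From mathcomp Require Export all_boot all_order all_algebra.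
From mathcomp Require Export finmap boolp classical_sets cardinality.

Set Implicit Arguments.
Unset Strict Implicit.
Unset Printing Implicit Defensive.

Import GRing.Theory.

Local Open Scope ring_scope.

Definition nice (G : zmodType) (A : {fset G}) : Prop :=
  0 \notin A /\ \sum_(z <- A) z <> 0.

Definition partial_sum (G : zmodType) (w : seq G) (i : nat) : G :=
  \sum_(x <- take i w) x.

(* [perm_eq w A]: the sequence w lists every element of A exactly once. *)
Definition alspach_ordering (G : zmodType) (A : {fset G}) (w : seq G) : Prop :=
  [/\ perm_eq w A,
      forall i, (1 <= i <= size w)%N -> partial_sum w i <> 0
    & forall i j, (1 <= i)%N -> (i < j)%N -> (j <= size w)%N ->
        partial_sum w i <> partial_sum w j].

Definition nice_subsets_orderable (G : zmodType) (k : nat) : Prop :=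
  forall A : {fset G}, #|` A| = k -> nice A ->
    exists w : seq G, alspach_ordering A w.

Definition torsion_free (G : zmodType) : Prop :=
  forall (x : G) (n : nat), (0 < n)%N -> x *+ n = 0 -> x = 0.

(* Main.v *)
Require Import Defs.

(** Whether an ordering of [A] is Alspach depends only on which pairs of subsets
    of [A] have equal sums.  A torsion-free [G] behaves here like a rational
    vector space: the coincidences between subset sums of [A] span a subspace of
    [Q^k] containing no further coincidence, so a generic vector orthogonal to
    this subspace, cleared of denominators, is a family of integers with exactly
    the same coincidences.  Reducing modulo a prime larger than all differences
    of subset sums creates no new one, so an Alspach ordering in [Z_p] can be
    pulled back to [A]. *)

Set Implicit Arguments.
Unset Strict Implicit.
Unset Printing Implicit Defensive.

Import Order.TTheory GRing.Theory Num.Theory.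

Local Open Scope ring_scope.

(** * Clearing denominators and avoiding finitely many hyperplanes *)

Lemma rat_mx_clear_denom m n (u : 'M[rat]_(m, n)) :
  exists2 d : int, d != 0 &
    exists z : 'M[int]_(m, n), d%:~R *: u = map_mx intr z.
Proof.
pose D := \prod_(ij : 'I_m * 'I_n) denq (u ij.1 ij.2).
exists D; first by apply/prodf_neq0 => ij _; exact: denq_neq0.
exists (\matrix_(i, j) (numq (u i j) *
  \prod_(ij : 'I_m * 'I_n | ij != (i, j)) denq (u ij.1 ij.2))).
apply/matrixP => i j; rewrite !mxE /D (bigD1 (i, j)) //= !rmorphM /=.
by rewrite mulrAC numqE [_ * u i j]mulrC.
Qed.

Lemma map_mx_intr_inj (R : numDomainType) m n :
  injective (map_mx intr : 'M[int]_(m, n) -> 'M[R]_(m, n)).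
Proof.
move=> u v /matrixP uv; apply/matrixP => i j.
by have := uv i j; rewrite !mxE => /intr_inj.
Qed.

Lemma poly_nat_nonroot (R : numDomainType) (p : {poly R}) :
  p != 0 -> exists n : nat, p.[n%:R] != 0.
Proof.
move=> p0; pose s := [seq i%:R : R | i <- iota 0 (size p)].
have us : uniq s.
  rewrite map_inj_uniq ?iota_uniq // => i j /eqP.
  by rewrite eqr_nat => /eqP.
have /allPn[_ /mapP[n _ ->] h] : ~~ all (root p) s.
  apply/negP => rs; have := max_poly_roots p0 rs us.
  by rewrite size_map size_iota ltnn.
by exists n.
Qed.

(** Read each row as the coefficients of a polynomial. The product of the nonzero ones has a natural
    non-root [n], and the column of powers of [n] sends each row to the value of its polynomial at
    [n]. *)
Lemma generic_vector (R : numDomainType) (I : finType) k (v : I -> 'rV[R]_k) :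
  exists c : 'cV[R]_k, forall i, v i != 0 -> v i *m c != 0.
Proof.
pose q := \prod_(i | v i != 0) rVpoly (v i).
have q0 : q != 0.
  apply/prodf_neq0 => i; apply: contra_neq => h.
  by rewrite -[v i]rVpolyK h linear0.
have [n] := poly_nat_nonroot q0.
rewrite horner_prod => /prodf_neq0 qn.
exists (\col_j n%:R ^+ j) => i vi0.
apply: contra_neq (qn i vi0) => /matrixP/(_ ord0 ord0).
rewrite !mxE => h; rewrite (horner_coef_wide _ (size_poly _ _)) -[RHS]h.
by apply: eq_bigr => j _; rewrite coef_rVpoly_ord mxE.
Qed.

(** * Integer models of families in a torsion-free group *)

Section IntegerModel.

Variables (G : zmodType) (k : nat) (x : 'I_k -> G).
Hypothesis tfG : torsion_free G.

Definition int_comb (e : 'rV[int]_k) : G := \sum_i x i *~ e 0 i.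

Lemma torsion_free_mulrz (g : G) (d : int) : d != 0 -> g *~ d = 0 -> g = 0.
Proof.
case: d => n d0 h; first by apply: (@tfG g n) => //; rewrite lt0n.
by apply: (@tfG g n.+1) => //; apply/eqP; rewrite -oppr_eq0; apply/eqP.
Qed.

Lemma int_combZ d e : int_comb (d *: e) = int_comb e *~ d.
Proof.
rewrite /int_comb mulrz_suml; apply: eq_bigr => i _.
by rewrite mxE mulrC mulrzA.
Qed.

Lemma int_comb_mulmx n (z : 'rV[int]_n) (M : 'M[int]_(n, k)) :
  int_comb (z *m M) = \sum_j int_comb (row j M) *~ z 0 j.
Proof.
rewrite /int_comb; under [RHS]eq_bigr do rewrite mulrz_suml.
rewrite exchange_big; apply: eq_bigr => i _ /=.
rewrite mxE mulrz_sumr; apply: eq_bigr => j _.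
by rewrite mxE mulrC mulrzA.
Qed.

(** Scaling by a common denominator [d] of the rational coefficients gives an integer combination,
    so [int_comb e *~ d = 0], and torsion-freeness cancels [d]. *)
Lemma int_comb_rat_span n (M : 'M[int]_(n, k)) (e : 'rV[int]_k) :
    (forall j, int_comb (row j M) = 0) ->
    (map_mx intr e <= (map_mx intr M : 'M[rat]_(n, k)))%MS ->
  int_comb e = 0.
Proof.
move=> M0 /submxP[u eu]; have [d d0 [z dz]] := rat_mx_clear_denom u.
apply: (torsion_free_mulrz d0); rewrite -int_combZ.
suff -> : d *: e = z *m M.
  by rewrite int_comb_mulmx big1 // => j _; rewrite M0 mul0rz.
apply: (@map_mx_intr_inj rat).
by rewrite map_mxZ map_mxM eu -dz scalemxAl.
Qed.

Lemma integer_model (I : finType) (E : I -> 'rV[int]_k) :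
  exists y : 'cV[int]_k, forall i, int_comb (E i) = 0 <-> E i *m y = 0.
Proof.
(* Rows that are not relations are replaced by [0], so the row space is spanned by the relations
   alone. *)
pose M := \matrix_(j < #|I|)
  if int_comb (E (enum_val j)) == 0 then E (enum_val j) else 0 : 'M[int]_(_, k).
pose MQ : 'M[rat]_(_, k) := map_mx intr M.
pose EQ i : 'rV[rat]_k := map_mx intr (E i).
have M0 j : int_comb (row j M) = 0.
  rewrite rowK; case: eqP => // _.
  by rewrite /int_comb big1 // => i _; rewrite mxE.
(* [cokermx MQ] kills exactly the row space of [MQ], and [c] kills none of the surviving images. The
   model [y] is [cokermx MQ *m c] cleared of denominators. *)
have [c cP] := generic_vector (fun i => EQ i *m cokermx MQ).
have [d d0 [y yP]] := rat_mx_clear_denom (cokermx MQ *m c).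
have Ey i : map_mx intr (E i *m y) = d%:~R *: (EQ i *m cokermx MQ *m c).
  by rewrite map_mxM -yP -scalemxAr mulmxA.
exists y => i; split=> [Ei0 | Ei0].
  apply: (@map_mx_intr_inj rat).
  rewrite Ey map_mx0.
  suff /eqP-> : EQ i *m cokermx MQ == 0 by rewrite mul0mx scaler0.
  rewrite -submxE; suff <- : row (enum_rank i) MQ = EQ i by apply: row_sub.
  by rewrite -map_row rowK enum_rankK Ei0 eqxx.
apply: (int_comb_rat_span M0); rewrite submxE.
apply/negPn/negP => /cP/negP; apply.
have /eqP := Ey i; rewrite Ei0 map_mx0 eq_sym scaler_eq0 intr_eq0.
by rewrite (negPf d0).
Qed.

Lemma integer_subset_sum_model :
  exists y : 'I_k -> int, forall B C : {set 'I_k},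
    \sum_(i in B) x i = \sum_(i in C) x i <->
    \sum_(i in B) y i = \sum_(i in C) y i.
Proof.
(* With differences of indicator vectors, a vanishing combination is a coincidence of two subset
   sums. *)
pose E (BC : {set 'I_k} * {set 'I_k}) : 'rV[int]_k :=
  \row_i ((i \in BC.1)%:R - (i \in BC.2)%:R).
have [y yP] := integer_model E.
exists (fun i => y i 0) => B C; have := yP (B, C).
have -> : int_comb (E (B, C)) = \sum_(i in B) x i - \sum_(i in C) x i.
  rewrite /int_comb [in RHS]big_mkcond [\sum_(i in C) _]big_mkcond /= -sumrB.
  apply: eq_bigr => i _; rewrite mxE /= mulrzBr.
  by case: (i \in B); case: (i \in C).
have Ey : (E (B, C) *m y) 0 0 = \sum_(i in B) y i 0 - \sum_(i in C) y i 0.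
  rewrite mxE [in RHS]big_mkcond [\sum_(i in C) _]big_mkcond /= -sumrB.
  apply: eq_bigr => i _; rewrite mxE /= mulrBl.
  by case: (i \in B); case: (i \in C); rewrite ?mul0r ?mul1r.
move=> [h1 h2]; split=> [/eqP|] h.
  move: h; rewrite -subr_eq0 => /eqP/h1 h.
  by apply/eqP; rewrite -subr_eq0 -Ey h mxE.
apply/eqP; rewrite -subr_eq0; apply/eqP/h2/matrixP => a b.
by rewrite !ord1 Ey h subrr mxE.
Qed.

End IntegerModel.

(** * Reduction modulo a large prime *)

Lemma Zp_intr_eq0 (p : nat) (z : int) :
  (1 < p)%N -> (`|z| < p)%N -> z%:~R = 0 :> 'Z_p -> z = 0.
Proof.
move=> p1 zp z0; have : (`|z|%N)%:R = 0 :> 'Z_p.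
  by case: z z0 {zp} => n //= /eqP; rewrite oppr_eq0 => /eqP.
move/(congr1 val); rewrite /= val_Zp_nat // modn_small //.
by move=> /eqP; rewrite absz_eq0 => /eqP.
Qed.

Lemma Zp_subset_sum_model (k : nat) (y : 'I_k -> int) :
  exists N : nat, forall p : nat, (N < p)%N -> (1 < p)%N ->
    forall B C : {set 'I_k},
      \sum_(i in B) y i = \sum_(i in C) y i <->
      \sum_(i in B) (y i)%:~R = \sum_(i in C) (y i)%:~R :> 'Z_p.
Proof.
pose D (BC : {set 'I_k} * {set 'I_k}) : int :=
  \sum_(i in BC.1) y i - \sum_(i in BC.2) y i.
(* Beyond the largest absolute difference of two subset sums, a nonzero difference cannot vanish
   modulo [p]. *)
exists (\max_BC `|D BC|%N) => p Np p1 B C.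
rewrite -!(rmorph_sum intr) /=; split=> [-> // | h].
apply/eqP; rewrite -subr_eq0; apply/eqP.
apply: (@Zp_intr_eq0 p) => //; last by rewrite rmorphB /= h subrr.
exact: leq_ltn_trans (leq_bigmax (B, C)) Np.
Qed.

Lemma infinite_nat_above (P : set nat) (N : nat) :
  infinite_set P -> exists2 p, P p & (N < p)%N.
Proof.
move=> infP; apply: contrapT => noP; apply: infP.
apply: sub_finite_set (finite_II N.+1) => p Pp /=.
by rewrite ltnNge; apply/negP => Np; apply: noP; exists p.
Qed.

Lemma uniq_sum_set (G : zmodType) (T : finType) (f : T -> G) (s : seq T) :
  uniq s -> \sum_(i <- s) f i = \sum_(i in [set j in s]) f i.
Proof.
move=> us; rewrite big_uniq //=.
by apply: eq_bigl => i; rewrite inE.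
Qed.

(** Induction on [w], removing from [s] a preimage of the head. This turns an ordering of the values
    into an ordering of the indices. *)
Lemma perm_eq_map_lift (S T : eqType) (f : S -> T) (w : seq T) (s : seq S) :
  perm_eq w (map f s) -> exists2 v, perm_eq v s & w = map f v.
Proof.
elim: w s => [|a w IHw] s ws.
  by exists [::] => //; case: s ws => // b s /perm_size.
have /mapP[i si ai] : a \in map f s by rewrite -(perm_mem ws) mem_head.
have sE := perm_to_rem si.
move: ws; rewrite (permPr (perm_map f sE)) /= ai perm_cons => /IHw[v vs ->].
by exists (i :: v); rewrite // (permPr sE) perm_cons.
Qed.

(** * Transfer between families with the same coincidences *)

Section Transfer.

Variables (G H : zmodType) (k : nat) (x : 'I_k -> G) (y : 'I_k -> H).
Hypothesis xy : forall B C : {set 'I_k},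
  \sum_(i in B) x i = \sum_(i in C) x i <->
  \sum_(i in B) y i = \sum_(i in C) y i.

Lemma subset_sum_eq0 (B : {set 'I_k}) :
  \sum_(i in B) x i = 0 <-> \sum_(i in B) y i = 0.
Proof. by have := xy B finset.set0; rewrite !big_set0. Qed.

Lemma model_eq i j : x i = x j <-> y i = y j.
Proof. by have := xy [set i] [set j]; rewrite !big_set1. Qed.

Lemma model_eq0 i : x i = 0 <-> y i = 0.
Proof. by have := subset_sum_eq0 [set i]; rewrite !big_set1. Qed.

Lemma partial_sum_map (K : zmodType) (f : 'I_k -> K) v n : uniq v ->
  partial_sum (map f v) n = \sum_(i in [set j in take n v]) f i.
Proof.
by move=> uv; rewrite /partial_sum -map_take big_map uniq_sum_set ?take_uniq.
Qed.

(** Both niceness and the Alspach conditions compare subset sums: [0] is the empty sum, an element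
    is a singleton sum, and a partial sum is the sum over the set of indices in a prefix. *)
Lemma alspach_transfer (A : {fset G}) :
    perm_eq (map x (enum 'I_k)) A -> nice A ->
    nice_subsets_orderable H k ->
  exists w : seq G, alspach_ordering A w.
Proof.
move=> xA [A0 Asum] orderH.
have injx : injective x.
  apply/injectiveP; rewrite /injectiveb /dinjectiveb.
  by rewrite (perm_uniq xA) fset_uniq.
have injy : injective y by move=> i j /model_eq/injx.
have uy : uniq (map y (enum 'I_k)) by rewrite map_inj_uniq ?enum_uniq.
pose B := [fset z in map y (enum 'I_k)]%fset.
have yB : perm_eq (map y (enum 'I_k)) B.
  by apply: uniq_perm => // [|z]; rewrite ?fset_uniq // inE.
have sizeB : #|` B| = k.
  by rewrite -(perm_size yB) size_map size_enum_ord.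
have niceB : nice B.
  split.
    rewrite -(perm_mem yB); apply/mapP => -[i _ /esym/model_eq0 xi0].
    by move/negP: A0; apply; rewrite -(perm_mem xA) -xi0 map_f ?mem_enum.
  rewrite -(perm_big _ yB) big_map uniq_sum_set ?enum_uniq //=.
  move=> /subset_sum_eq0 s0; apply: Asum.
  by rewrite -(perm_big _ xA) big_map uniq_sum_set ?enum_uniq.
have [w [wB w0 wd]] := orderH B sizeB niceB.
have [v ve wE] : exists2 v, perm_eq v (enum 'I_k) & w = map y v.
  by apply: perm_eq_map_lift; rewrite (perm_trans wB) // perm_sym.
have uv : uniq v by rewrite (perm_uniq ve) enum_uniq.
exists (map x v); split.
- by rewrite -(permPr xA) perm_map.
- move=> i; rewrite size_map partial_sum_map // => iv /subset_sum_eq0.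
  by rewrite -partial_sum_map // -wE; apply: w0; rewrite wE size_map.
- move=> i j i1 ij; rewrite size_map !partial_sum_map // => jv /xy.
  by rewrite -!partial_sum_map // -wE; apply: wd; rewrite // wE size_map.
Qed.

End Transfer.

Theorem theorem2p4 (k : nat) (hk : (0 < k)%N)
  (hp : infinite_set
          [set p : nat | prime p /\ nice_subsets_orderable 'Z_p k]%classic) :
  forall G : zmodType, torsion_free G -> nice_subsets_orderable G k.
Proof.
move=> G tfG A sizeA niceA.
(* The default [0] is never reached, since [A] has exactly [k] elements. *)
pose x (i : 'I_k) : G := nth 0 A i.
have xA : perm_eq (map x (enum 'I_k)) A.
  suff -> : map x (enum 'I_k) = A by [].
  by rewrite (map_comp (nth 0 A)) val_enum_ord -sizeA -/(mkseq _ _) mkseq_nth.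
have [y xy] := integer_subset_sum_model x tfG.
have [N NP] := Zp_subset_sum_model y.
have [p [pr_p orderp] Np] := infinite_nat_above N hp.
apply: (alspach_transfer _ xA niceA orderp) => B C.
exact: iff_trans (xy B C) (NP p Np (prime_gt1 pr_p) B C).
Qed.
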